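(* For any non-negative integer $n$ and any $\mathbf{x}\in\{0,1\}^n$: (1) $\#\mathrm{iS}^{(0)}_{PATH}(\mathbf{x})=1$; (2) $\#\mathrm{iS}^{(1)}_{PATH}(\mathbf{x})=n+2$. Moreover, (3) $\#\mathrm{iS}^{(2)}_{PATH}(00)\neq\#\mathrm{iS}^{(2)}_{PATH}(01)$.
   Context: A path insertion applied to a bit sequence $\mathbf{x}\in\{0,1\}^n$ produces a sequence of length $n+2$ of one of the forms $0\mathbf{z}$, where $\mathbf{z}$ is obtained from $\mathbf{x}$ by inserting one bit $1$ at any position (including the beginning and the end), or $1\mathbf{z}$, where $\mathbf{z}$ is obtained from $\mathbf{x}$ by inserting one bit $0$ at any position. $\mathrm{iS}_{PATH}(\mathbf{x})$ is the set of all sequences obtained from $\mathbf{x}$ by a single path insertion. Put $\mathrm{iS}^{(0)}_{PATH}(\mathbf{x}):=\{\mathbf{x}\}$ and $\mathrm{iS}^{(t)}_{PATH}(\mathbf{x}):=\bigcup_{\mathbf{y}\in\mathrm{iS}^{(t-1)}_{PATH}(\mathbf{x})}\mathrm{iS}_{PATH}(\mathbf{y})$ for $t\ge1$. *)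

(* Defs.v *)
From mathcomp Require Import all_boot.

Set Implicit Arguments.
Unset Strict Implicit.
Unset Printing Implicit Defensive.

(* The bits 0 and 1 are false and true. *)

Definition insert_bit (i : nat) (b : bool) (s : seq bool) : seq bool :=
  take i s ++ b :: drop i s.

Definition insertions (n : nat) (b : bool) (x : n.-tuple bool) :
    {set n.+1.-tuple bool} :=
  [set z | [exists i : 'I_n.+1, tval z == insert_bit i b x]].

Definition iS_PATH1 (n : nat) (x : n.-tuple bool) : {set n.+2.-tuple bool} :=
  [set [tuple of false :: z] | z : n.+1.-tuple bool in insertions true x] :|:
  [set [tuple of true :: z] | z : n.+1.-tuple bool in insertions false x].

(* The length is written t.*2 + n rather than n + 2 * t so that
   t.+1.*2 + n is convertible to (t.*2 + n).+2. *)
Fixpoint iS_PATH (t : nat) (n : nat) (x : n.-tuple bool) :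
    {set (t.*2 + n).-tuple bool} :=
  if t is t'.+1 then \bigcup_(y in iS_PATH t' x) iS_PATH1 y else [set x].

(* Main.v *)
(* Inserting the bit b anywhere in a run of b's gives the same word, so the
   distinct insertions of b into x correspond to the position before each bit of
   x other than b, together with the end of x: there are 1 + #{i | x_i <> b} of
   them.  Adding the contributions of b = 0 and b = 1, which are told apart by
   the leading bit, gives n + 2. *)
Require Import Defs.
From mathcomp Require Import all_boot.

Set Implicit Arguments.
Unset Strict Implicit.
Unset Printing Implicit Defensive.

(** Within a run of [b] only the position after its last letter is kept, so each word obtained by
    insertion is listed once. *)
Fixpoint insert_seqs (b : bool) (s : seq bool) : seq (seq bool) :=
  if s is a :: s' then
    let r := [seq a :: z | z <- insert_seqs b s'] in
    if a == b then r else (b :: s) :: r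
  else [:: [:: b]].

Lemma size_insert_seqs b s :
  size (insert_seqs b s) = (count (predC1 b) s).+1.
Proof.
elim: s => //= a s IHs; case: (a == b); rewrite /= size_map IHs.
  by rewrite add0n.
by rewrite add1n.
Qed.

(** A front insertion is listed only when [a <> b]; it starts with [b], all later entries with
    [a]. *)
Lemma uniq_insert_seqs b s : uniq (insert_seqs b s).
Proof.
elim: s => //= a s IHs.
have U : uniq [seq a :: z | z <- insert_seqs b s].
  by rewrite map_inj_uniq // => u v [].
case: eqP => //= nab; rewrite U andbT.
by apply/mapP => -[z _ [/esym]].
Qed.

(** If [s] starts with [b], the front insertion is skipped, but the same word arises by inserting
    behind that initial run. *)
Lemma mem_cons_insert_seqs b s : b :: s \in insert_seqs b s.
Proof.
elim: s => [|a s IHs] /=; first by rewrite mem_seq1.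
case: eqP => [->|_]; last exact: mem_head.
exact: map_f.
Qed.

Lemma insert_seqsP b s z :
  reflect (exists2 i, i <= size s & z = insert_bit i b s)
          (z \in insert_seqs b s).
Proof.
apply: (iffP idP) => [|[i le_i ->]].
  elim: s z => [|a s IHs] z /=; first by rewrite mem_seq1 => /eqP ->; exists 0.
  have tailP : z \in [seq a :: y | y <- insert_seqs b s] ->
      exists2 i, i <= (size s).+1 & z = insert_bit i b (a :: s).
    by case/mapP => y /IHs [i le_i ->] ->; exists i.+1.
  by case: ifP => // _; rewrite inE => /predU1P [->|/tailP //]; exists 0.
elim: s i le_i => [|a s IHs] [|i] //= le_i; first by rewrite mem_seq1.
  exact: (mem_cons_insert_seqs b (a :: s)).
have := map_f (cons a) (IHs i le_i).
by case: ifP => // _; rewrite inE => ->; rewrite orbT.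
Qed.

Lemma mem_insertions n b (x : n.-tuple bool) (z : n.+1.-tuple bool) :
  (z \in insertions b x) = (tval z \in insert_seqs b x).
Proof.
rewrite inE; apply/existsP/insert_seqsP => [[i /eqP ->]|[i le_i ->]].
  by exists i; first by rewrite size_tuple -ltnS ltn_ord.
by rewrite size_tuple -ltnS in le_i; exists (Ordinal le_i).
Qed.

Definition path_insert_seqs (s : seq bool) : seq (seq bool) :=
  [seq false :: z | z <- insert_seqs true s] ++
  [seq true :: z | z <- insert_seqs false s].

Lemma mem_iS_PATH1 n (x : n.-tuple bool) (z : n.+2.-tuple bool) :
  (z \in iS_PATH1 x) = (tval z \in path_insert_seqs x).
Proof.
have consE a b : (z \in [set [tuple of a :: y]
                       | y : n.+1.-tuple bool in insertions b x]) =
                 (tval z \in [seq a :: y | y <- insert_seqs b x]).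
  apply/imsetP/mapP => [[y yx ->]|[y yx zE]].
    by exists (tval y); first by rewrite -mem_insertions.
  have sz_y : size y == n.+1 by rewrite -eqSS -(size_tuple z) zE.
  by exists (Tuple sz_y); [rewrite mem_insertions | apply: val_inj].
by rewrite in_setU !consE mem_cat.
Qed.

Lemma size_path_insert_seqs s : size (path_insert_seqs s) = (size s).+2.
Proof.
rewrite size_cat !size_map !size_insert_seqs addSn addnS.
(* Each bit differs from exactly one of [true] and [false], so the two counts add up to the
   length. *)
rewrite -(count_predC (pred1 true) s) addnC; congr (_ + _).+2.
by apply: eq_count => -[].
Qed.

Lemma uniq_path_insert_seqs s : uniq (path_insert_seqs s).
Proof.
rewrite cat_uniq !map_inj_uniq ?uniq_insert_seqs; try by move=> u v [].
by rewrite andbT /=; apply/hasPn => _ /mapP [y _ ->]; apply/mapP => -[].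
Qed.

(** Repetitions can appear from the second round on, since different intermediate words may share a
    descendant; they are removed only when counting. *)
Definition path_seqs (t : nat) (s : seq bool) : seq (seq bool) :=
  iter t (fun l => flatten (map path_insert_seqs l)) [:: s].

Lemma size_mem_insert_seqs b s z :
  z \in insert_seqs b s -> size z = (size s).+1.
Proof.
case/insert_seqsP => i _ ->.
by rewrite size_cat /= addnS -size_cat cat_take_drop.
Qed.

Lemma size_mem_path_seqs t s z :
  z \in path_seqs t s -> size z = t.*2 + size s.
Proof.
elim: t z => [|t IHt] z /=; first by rewrite mem_seq1 => /eqP ->.
case/flatten_mapP => y /IHt sz_y; rewrite mem_cat doubleS !addSn -sz_y.
by case/orP => /mapP [u /size_mem_insert_seqs <- ->].
Qed.

Lemma mem_iS_PATH t n (x : n.-tuple bool) (z : (t.*2 + n).-tuple bool) :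
  (z \in iS_PATH t x) = (tval z \in path_seqs t x).
Proof.
elim: t z => [|t IHt] z /=; first by rewrite in_set1 mem_seq1.
apply/bigcupP/flatten_mapP => [[y yx zy]|[y yx zy]].
  by exists (tval y); rewrite -?IHt -?mem_iS_PATH1.
have sz_y : size y == t.*2 + n by rewrite (size_mem_path_seqs yx) size_tuple.
by exists (Tuple sz_y); rewrite ?IHt ?mem_iS_PATH1.
Qed.

(** This trades an abstract finite set for a list whose length can be evaluated. *)
Lemma card_iS_PATH t n (x : n.-tuple bool) :
  #|iS_PATH t x| = size (undup (path_seqs t x)).
Proof.
rewrite cardE -(size_map val); apply/perm_size/uniq_perm.
- by rewrite (map_inj_uniq val_inj) enum_uniq.
- exact: undup_uniq.
move=> z; rewrite mem_undup; apply/mapP/idP => [[y]|zx].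
  by rewrite mem_enum mem_iS_PATH => yx ->.
have sz_z : size z == t.*2 + n by rewrite (size_mem_path_seqs zx) size_tuple.
by exists (Tuple sz_z); first by rewrite mem_enum mem_iS_PATH.
Qed.

Theorem theorem11p3 :
  (forall (n : nat) (x : n.-tuple bool),
     #|iS_PATH 0 x| = 1 /\ #|iS_PATH 1 x| = n + 2) /\
  #|iS_PATH 2 [tuple false; false]| <> #|iS_PATH 2 [tuple false; true]|.
Proof.
split=> [n x|]; last first.
  (* The sizes are 15 for [00] (all words of length 6 with two 1s) and 16 for [01]. *)
  by apply/eqP; rewrite !card_iS_PATH; vm_compute.
split; first exact: cards1.
rewrite card_iS_PATH /= cats0 undup_id ?uniq_path_insert_seqs //.
by rewrite size_path_insert_seqs size_tuple addn2.
Qed.
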